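(* Let $m,n,l,p,r$ be positive integers and let $E,A\in\mathbb{R}^{m\times n}$, $B\in\mathbb{R}^{m\times l}$, $C\in\mathbb{R}^{p\times n}$, $K\in\mathbb{R}^{r\times n}$ (the pencil $\lambda E-A$ is not assumed to be regular or square). Consider the descriptor system $$E\dot x(t)=Ax(t)+Bu(t),\qquad y(t)=Cx(t),\qquad z(t)=Kx(t),$$ and let $\Psi$, $\Gamma$ and $\Omega(\lambda)$, $\lambda\in\mathbb{C}$, be the block matrices built from $(E,A,B,C,K)$ as defined in the context. Assume that $$\operatorname{rank}\Psi=\operatorname{rank}\Gamma$$ and that $$\operatorname{rank}\Omega(\lambda)=\operatorname{rank}\Gamma\qquad\text{for all }\lambda\in\mathbb{C}\text{ with }\operatorname{Re}\lambda\ge 0 .$$ Then there exists a functional ODE observer for the descriptor system, i.e. there exist an integer $q$ with $0\le q\le r$ and matrices $N\in\mathbb{R}^{q\times q}$, $H\in\mathbb{R}^{q\times(l+p)}$, $R\in\mathbb{R}^{r\times q}$, $M\in\mathbb{R}^{r\times(l+p)}$ such that the system $$\dot w(t)=Nw(t)+H\begin{bmatrix}u(t)\\ y(t)\end{bmatrix},\qquad \hat z(t)=Rw(t)+M\begin{bmatrix}u(t)\\ y(t)\end{bmatrix}$$ is a functional ODE observer for the descriptor system in the sense defined in the context.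
   Context: Block matrices. Put $\mathscr{E}=\begin{bmatrix}E & 0_{m\times l}\end{bmatrix}\in\mathbb{R}^{m\times(n+l)}$, $\mathscr{A}=\begin{bmatrix}A & B\end{bmatrix}\in\mathbb{R}^{m\times(n+l)}$, and $\mathcal{A}=\begin{bmatrix}0_{(n-1)m\times n}\\ A\end{bmatrix}\in\mathbb{R}^{nm\times n}$. Let $F\in\mathbb{R}^{nm\times n(n+l)}$ be the block upper bidiagonal matrix with $n$ block rows and $n$ block columns (blocks of size $m\times(n+l)$) whose diagonal blocks all equal $\mathscr{E}$, whose first superdiagonal blocks all equal $\mathscr{A}$, and whose remaining blocks are zero: $$F=\begin{bmatrix}\mathscr{E}&\mathscr{A}&&\\ &\ddots&\ddots&\\ &&\mathscr{E}&\mathscr{A}\\ &&&\mathscr{E}\end{bmatrix}.$$ With zero blocks of appropriate sizes (the last two block columns have $n$ columns each), define $$\Gamma=\begin{bmatrix}F&\mathcal{A}&0\\0&E&A\\0&C&0\\0&0&C\\0&0&K\end{bmatrix},\qquad \Psi=\begin{bmatrix}F&\mathcal{A}&0\\0&E&A\\0&C&0\\0&0&C\\0&0&K\\0&K&0\end{bmatrix},\qquad \Omega(\lambda)=\begin{bmatrix}F&\mathcal{A}&0\\0&E&A\\0&C&0\\0&0&C\\0&K&\lambda K\end{bmatrix}\quad(\lambda\in\mathbb{C}).$$ Solutions. $\mathscr{L}^1_{\mathrm{loc}}(\mathbb{R};\mathbb{R}^d)$ denotes the measurable, locally Lebesgue integrable functions $\mathbb{R}\to\mathbb{R}^d$ and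 $\mathcal{AC}_{\mathrm{loc}}(\mathbb{R};\mathbb{R}^d)$ the locally absolutely continuous ones. Functions in $\mathscr{L}^1_{\mathrm{loc}}$ that are equal almost everywhere are identified; in particular $Ex\in\mathcal{AC}_{\mathrm{loc}}$ means that $Ex$ agrees almost everywhere with a locally absolutely continuous function, and $E\dot x$ denotes the (almost everywhere defined) derivative of that function. The behavior of the descriptor system is $$\mathscr{B}=\{(x,u,y,z)\in\mathscr{L}^1_{\mathrm{loc}}(\mathbb{R};\mathbb{R}^{n+l+p+r})\mid Ex\in\mathcal{AC}_{\mathrm{loc}}(\mathbb{R};\mathbb{R}^m)\text{ and }(x,u,y,z)\text{ satisfies the descriptor system for almost all }t\in\mathbb{R}\}.$$ It is a standing assumption that $\mathscr{B}$ is nonempty. Functional ODE observer. Here $f(t)\to0$ as $t\to\infty$ means $\lim_{t\to\infty}\operatorname{ess\,sup}_{[t,\infty)}\|f\|=0$. A system $$\dot w(t)=Nw(t)+H\begin{bmatrix}u(t)\\ y(t)\end{bmatrix},\qquad \hat z(t)=Rw(t)+M\begin{bmatrix}u(t)\\ y(t)\end{bmatrix}$$ with $N\in\mathbb{R}^{q\times q}$, $0\le q\le r$, $H\in\mathbb{R}^{q\times(l+p)}$, $R\in\mathbb{R}^{r\times q}$, $M\in\mathbb{R}^{r\times(l+p)}$ (for $q=0$ this is the static system $\hat z=M\begin{bmatrix}u\\ y\end{bmatrix}$) is called a functional ODE observer for the descriptor system if for every $(x,u,y,z)\in\mathscr{B}$ there exist $w\in\mathcal{AC}_{\mathrm{loc}}(\mathbb{R};\mathbb{R}^q)$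 and $\hat z\in\mathscr{L}^1_{\mathrm{loc}}(\mathbb{R};\mathbb{R}^r)$ such that $(w,u,y,\hat z)$ satisfies the observer equations for almost all $t\in\mathbb{R}$, and for all $w,\hat z$ with this property: (a) $\hat z(t)-z(t)\to0$ as $t\to\infty$; (b) if $z(0)=\hat z(0)$, then $z=\hat z$ almost everywhere. In (b), since $z,\hat z$ are only determined up to null sets, ''$z(0)=\hat z(0)$'' means that $\hat z-z$ agrees almost everywhere with a continuous function $\mathbb{R}\to\mathbb{R}^r$ that vanishes at $t=0$. *)

(* Defs.v *)
From HB Require Import structures.
From mathcomp Require Import all_boot all_order all_algebra.
From mathcomp Require Import all_classical all_reals all_analysis.
From mathcomp Require Import ess_sup_inf complex.

Set Implicit Arguments.
Unset Strict Implicit.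
Unset Printing Implicit Defensive.

Import Order.TTheory GRing.Theory Num.Theory.
Import numFieldNormedType.Exports.

Local Open Scope classical_set_scope.
Local Open Scope ring_scope.

Section BlockMatrices.
Context {k : fieldType} {m n l p r : nat}.
Variables (E A : 'M[k]_(m, n)) (B : 'M[k]_(m, l)).
Variables (C : 'M[k]_(p, n)) (K : 'M[k]_(r, n)).

Definition scrE : 'M[k]_(m, n + l) := row_mx E 0.

Definition scrA : 'M[k]_(m, n + l) := row_mx A B.

(* The height n * m and the width n * (n + l) are kept in the form
   \sum_(i < n) m and \sum_(i < n) (n + l) given by \mxblock and \mxcol. *)
Definition calA : 'M[k]_(\sum_(i < n) m, n) :=
  \mxcol_(i < n) (if i.+1 == n then A else 0).

Definition bidiagF : 'M[k]_(\sum_(i < n) m, \sum_(j < n) (n + l)) :=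
  \mxblock_(i < n, j < n)
    (if j == i :> nat then scrE else if j == i.+1 :> nat then scrA else 0).

Definition row_mx3 (h w1 w2 w3 : nat) (X : 'M[k]_(h, w1)) (Y : 'M[k]_(h, w2))
    (Z : 'M[k]_(h, w3)) : 'M[k]_(h, w1 + (w2 + w3)) :=
  row_mx X (row_mx Y Z).

Definition Gamma :=
  col_mx (row_mx3 bidiagF calA 0)
 (col_mx (row_mx3 0       E    A)
 (col_mx (row_mx3 0       C    0)
 (col_mx (row_mx3 0       0    C)
         (row_mx3 0       0    K)))).

Definition Psi :=
  col_mx (row_mx3 bidiagF calA 0)
 (col_mx (row_mx3 0       E    A)
 (col_mx (row_mx3 0       C    0)
 (col_mx (row_mx3 0       0    C)
 (col_mx (row_mx3 0       0    K)
         (row_mx3 0       K    0))))).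

Definition Omega_at (lambda : k) :=
  col_mx (row_mx3 bidiagF calA 0)
 (col_mx (row_mx3 0       E    A)
 (col_mx (row_mx3 0       C    0)
 (col_mx (row_mx3 0       0    C)
         (row_mx3 0       K    (lambda *: K))))).

End BlockMatrices.

(* Omega(lambda) is a complex matrix: the real data are embedded in R[i]. *)
Definition Omega {R : realType} {m n l p r : nat} (E A : 'M[R]_(m, n))
    (B : 'M[R]_(m, l)) (C : 'M[R]_(p, n)) (K : 'M[R]_(r, n)) (lambda : R[i]) :=
  let toC a b (X : 'M[R]_(a, b)) := map_mx (real_complex R) X in
  Omega_at (toC _ _ E) (toC _ _ A) (toC _ _ B) (toC _ _ C) (toC _ _ K) lambda.

Section Solutions.
Context {R : realType}.

Local Notation mu := (@lebesgue_measure R).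

(* [locally_integrable] asks for Borel measurability; closing it under equality
   almost everywhere gives the Lebesgue measurable, locally integrable
   functions. *)
Definition L1loc {d : nat} (f : R -> 'cV[R]_d) : Prop :=
  forall i : 'I_d, exists2 g : R -> R, locally_integrable [set: R] g &
    \forall t \ae mu, f t i 0 = g t.

(* Epsilon-delta absolute continuity on every compact interval [a, b]; a list
   of pairs I stands for a finite family of nonoverlapping subintervals
   [I.1, I.2]. *)
Definition AC_loc {V : normedModType R} (f : R -> V) : Prop :=
  forall a b eps : R, 0 < eps -> exists2 delta : R, 0 < delta &
    forall s : seq (R * R),
      all (fun I => [&& a <= I.1, I.1 <= I.2 & I.2 <= b]) s ->
      pairwise (fun I J => (I.2 <= J.1) || (J.2 <= I.1)) s ->
      \sum_(I <- s) (I.2 - I.1) < delta ->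
      \sum_(I <- s) `|f I.2 - f I.1| < eps.

(* The function under the essential supremum is nonnegative and vanishes
   outside [t, +oo[, so this is its essential supremum over [t, +oo[. The norm
   of 'cV[R]_d is the maximum norm. *)
Definition ess_cvg0 {d : nat} (f : R -> 'cV[R]_d) : Prop :=
  ess_sup mu ((fun s => `|f s|%:E) \_ `[t, +oo[%classic) @[t --> +oo%R]
    --> (0 : \bar R).

Context {m n l p r : nat}.
Variables (E A : 'M[R]_(m, n)) (B : 'M[R]_(m, l)).
Variables (C : 'M[R]_(p, n)) (K : 'M[R]_(r, n)).

Definition trajectory : Type :=
  (R -> 'cV[R]_n) * (R -> 'cV[R]_l) * (R -> 'cV[R]_p) * (R -> 'cV[R]_r).

(* [v] is the locally absolutely continuous representative of E x; only E x,
   not x, is differentiated. *)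
Definition behavior : set trajectory :=
  [set s : trajectory | let: (x, u, y, z) := s in
    [/\ L1loc x, L1loc u, L1loc y & L1loc z] /\
    exists v : R -> 'cV[R]_m,
      [/\ AC_loc v,
          \forall t \ae mu, E *m x t = v t &
          \forall t \ae mu,
            [/\ is_derive (t : R) 1 v (A *m x t + B *m u t),
                y t = C *m x t & z t = K *m x t]]].

Section Observer.
Context {q : nat}.
Variables (N : 'M[R]_q) (H : 'M[R]_(q, l + p)).
Variables (Rw : 'M[R]_(r, q)) (M : 'M[R]_(r, l + p)).

Definition observer_solution (u : R -> 'cV[R]_l) (y : R -> 'cV[R]_p)
    (w : R -> 'cV[R]_q) (zhat : R -> 'cV[R]_r) : Prop :=
  [/\ AC_loc w, L1loc zhat &
      \forall t \ae mu,
        is_derive (t : R) 1 w (N *m w t + H *m col_mx (u t) (y t)) /\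
        zhat t = Rw *m w t + M *m col_mx (u t) (y t)].

(* z(0) = zhat(0), for functions determined up to null sets. *)
Definition agree_at0 (z zhat : R -> 'cV[R]_r) : Prop :=
  exists g : R -> 'cV[R]_r,
    [/\ continuous g, \forall t \ae mu, zhat t - z t = g t & g 0 = 0].

Definition functional_ODE_observer : Prop :=
  forall x u y z, behavior (x, u, y, z) ->
    (exists w zhat, observer_solution u y w zhat) /\
    (forall w zhat, observer_solution u y w zhat ->
       ess_cvg0 (fun t => zhat t - z t) /\
       (agree_at0 z zhat -> \forall t \ae mu, z t = zhat t)).

End Observer.

End Solutions.

(* Main.v *)
Require Import Defs.
From HB Require Import structures.
From mathcomp Require Import all_boot all_order all_algebra.
From mathcomp Require Import all_classical all_reals all_analysis.
From mathcomp Require Import measurable_realfun ess_sup_inf complex.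
From mathcomp Require Import ring lra.

Set Implicit Arguments.
Unset Strict Implicit.
Unset Printing Implicit Defensive.

Import Order.TTheory GRing.Theory Num.Theory.
Import numFieldNormedType.Exports.

Local Open Scope classical_set_scope.
Local Open Scope ring_scope.

(** Let v be the absolutely continuous representative of E x, let X = [0 K 0] and
    Y = [0 0 K] be the block rows made of K, and let Q consist of the rows of Gamma
    other than Y.

    The equality of the ranks of Psi and Gamma says that X is in the row space of
    Q and Y, so that on the kernel of Q the value of X is a linear function of the
    value of Y. The condition on Omega says that this function, which is only
    defined on a subspace, has no eigenvector that would belong to an unstable
    eigenvalue of the observer. Such a partial map has an extension to the whole
    space with all eigenvalues in the open left half plane [pencil_extension], so
    there is a Hurwitz matrix N with X + N Y in the row space of Q
    [hurwitz_relation]. The coefficients of this combination of rows are matrices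
    with
      L1 F = 0,  K = L1 calA + L2 E + L3 C,  N K = L2 A + L4 C.

    The relation L1 F = 0 is a chain of hidden constraints. Its first block
    annihilates E, hence v; differentiating v, and never x or u, shows that each
    following block annihilates v as well, and that the last block g satisfies
    g (A x + B u) = 0 [hidden_constraints]. Therefore L1 calA x = - g B u is known,
    z is L2 v plus a known term, and w = L2 v solves an observer with system matrix
    N, driven by u and y [functional_is_observer_solution]. The observer has order
    q = r and R = 1.

    Any other solution of the observer differs from L2 v by a locally absolutely
    continuous e with e' = N e almost everywhere, and zhat - z = e. A quadratic
    Lyapunov function [hurwitz_lyapunov] shows that e decays, and Gronwall's
    argument that e = 0 if e(0) = 0. Both reduce to one fact about real functions,
    that an absolutely continuous function with almost everywhere nonpositive
    derivative is nonincreasing [AC_nonincreasing]. *)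

(** * Endomorphisms with prescribed values on a subspace *)

Section PencilExtension.
Context {k K : fieldType} (f : {rmorphism k -> K}).

Local Notation "X ^f" := (map_mx f X).

Lemma row_freeP_inj (F : fieldType) (a b : nat) (X : 'M[F]_(a, b)) :
  reflect (forall v : 'rV_a, v *m X = 0 -> v = 0) (row_free X).
Proof.
rewrite -kermx_eq0; apply: (iffP eqP) => [kX0 v /sub_kermxP|vX].
  by rewrite kX0 submx0 => /eqP.
apply/row_matrixP => i; rewrite row0; apply: vX.
by rewrite -row_mul mulmx_ker row0.
Qed.

(** The projection onto the row space of J along that of Th, in the coordinates
    of J. *)
Lemma pencil_projection (d r : nat) (J Th : 'M[k]_(d, r)) :
  row_free J -> (J :&: Th = 0)%MS ->
  exists2 P : 'M[k]_(r, d), J *m P = 1%:M & Th *m P = 0.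
Proof.
move=> fJ JTh; pose Q := proj_mx <<J>>%MS <<Th>>%MS.
have QJTh : (<<J>> :&: <<Th>> = 0)%MS.
  by apply/eqP; rewrite -submx0 -JTh capmxS ?genmxE.
exists (Q *m pinvmx J); rewrite mulmxA.
  by rewrite proj_mx_id ?genmxE// mulmxVp.
by rewrite proj_mx_0 ?genmxE// mul0mx.
Qed.

(** A map T known only on a subspace, included by J, extends to an endomorphism N
    without bad eigenvalue as soon as no bad c is an eigenvalue of the known
    part; this is dual to stabilization by state feedback. Let D be the subspace
    and D2 the part of D that T maps into D. On D2, T is a partial endomorphism
    of D, so by induction it extends to an endomorphism N' of D without bad
    eigenvalue. The difference T - N' vanishes on D2 and otherwise leaves D,
    hence some projection P onto D kills its image. Then T followed by P is N',
    and P followed by T extends T; these two composites have the same nonzero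
    eigenvalues, which is why 0 must not be bad. *)
Lemma pencil_extension (bad : K -> Prop) (d r : nat) (J T : 'M[k]_(d, r)) :
  ~ bad 0 -> row_free J ->
  (forall c, bad c -> row_free (T^f - c *: J^f)) ->
  exists2 N : 'M[k]_r, J *m N = T &
    forall c, bad c -> row_free (N^f - c%:M).
Proof.
move=> bad0; elim/ltn_ind: d r J T => d IH r J T fJ fT.
pose D2 := kermx (T *m cokermx J); pose G := row_base D2.
have fG : row_free G := row_base_free _.
have GTJ : (G *m T <= J)%MS.
  rewrite submxE -mulmxA; apply/eqP/sub_kermxP.
  by rewrite eq_row_base.
pose T2 := G *m T *m pinvmx J.
have T2J : T2 *m J = G *m T by rewrite mulmxKpV.
have fT2 c : bad c -> row_free (T2^f - c *: G^f).
  move=> bc; apply/row_freeP_inj => v v0.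
  have : v *m G^f *m (T^f - c *: J^f) = 0.
    have -> : v *m G^f *m (T^f - c *: J^f) = v *m (T2^f - c *: G^f) *m J^f.
      rewrite -!mulmxA; congr (_ *m _).
      by rewrite mulmxBr mulmxBl -!map_mxM T2J -scalemxAr -scalemxAl -!map_mxM.
    by rewrite v0 mul0mx.
  move/(row_freeP_inj _ (fT _ bc)) => vG.
  by apply: (row_freeP_inj _ _ _ vG); rewrite row_free_map.
have [N' GN' fN'] : exists2 N' : 'M[k]_d, G *m N' = T2 &
    forall c, bad c -> row_free (N'^f - c%:M).
  (* When D2 is all of D, there is nothing to extend: T itself acts on D. *)
  have := rank_leq_row D2; rewrite leq_eqVlt => /orP[/eqP rD2|/IH/(_ d)].
  - have uG : row_full G by rewrite /row_full eq_row_base rD2.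
    have VG : pinvmx G *m G = 1%:M by rewrite mulVpmx.
    have GV : G *m pinvmx G = 1%:M by rewrite mulmxVp.
    exists (pinvmx G *m T2); first by rewrite mulmxA GV mul1mx.
    move=> c bc; apply/row_freeP_inj => v v0.
    apply: (row_freeP_inj _ (fT _ bc)).
    have -> : T^f = (pinvmx G *m T2)^f *m J^f.
      by rewrite -map_mxM -mulmxA T2J mulmxA VG mul1mx.
    by rewrite -mul_scalar_mx -mulmxBl mulmxA v0 mul0mx.
  - exact.
pose Th := T - N' *m J.
have GTh : G *m Th = 0 by rewrite mulmxBr mulmxA GN' T2J subrr.
have JTh : (J :&: Th = 0)%MS.
  apply/eqP; rewrite -submx0; apply/row_subP => i.
  set v := row i _.
  have /andP[vJ /submxP[x vx]] : (v <= J)%MS && (v <= Th)%MS.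
    by rewrite -sub_capmx row_sub.
  have : (x <= G)%MS.
    rewrite eq_row_base; apply/sub_kermxP; apply/eqP; rewrite mulmxA -submxE.
    have -> : x *m T = v + x *m N' *m J.
      by rewrite vx mulmxBr mulmxA subrK.
    by rewrite addmx_sub// submxMl.
  by case/submxP => y xy; rewrite vx xy -mulmxA GTh mulmx0 submx0.
have [P JP ThP] := pencil_projection fJ JTh.
have TP : T *m P = N'.
  by rewrite -[T](subrK (N' *m J)) -/Th mulmxDl ThP add0r -mulmxA JP mulmx1.
exists (P *m T); first by rewrite mulmxA JP mul1mx.
move=> c bc; apply/row_freeP_inj => v.
rewrite mulmxBr => /eqP; rewrite subr_eq0 => /eqP vc.
have vP : v *m P^f = 0.
  apply: (row_freeP_inj _ (fN' _ bc)).
  rewrite -TP mulmxBr [X in X - _](_ : _ = v *m (P *m T)^f *m P^f).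
    by rewrite vc !mul_mx_scalar -scalemxAl subrr.
  by rewrite !map_mxM !mulmxA.
have := vc; rewrite map_mxM mulmxA vP mul0mx mul_mx_scalar => /esym/eqP.
rewrite scaler_eq0 => /orP[/eqP c0|/eqP//].
by case: bad0; rewrite -c0.
Qed.

End PencilExtension.

Lemma row_free_factor (F : fieldType) (w r : nat) (S : 'M[F]_(w, r)) :
  exists d (J : 'M[F]_(d, r)) (U : 'M[F]_(w, d)) (W : 'M[F]_(d, w)),
    [/\ U *m J = S, W *m S = J & row_free J].
Proof.
exists (\rank S), (row_base S), (col_base S), (pinvmx (col_base S)).
rewrite mulmx_base row_base_free; split=> //.
by rewrite -[RHS]mul1mx -(mulVpmx (col_base_full S)) -mulmxA mulmx_base.
Qed.

Section HurwitzRelation.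
Context {R : rcfType}.
Local Notation cx := (map_mx (real_complex R)).

Definition hurwitz (r : nat) (N : 'M[R]_r) :=
  forall c : R[i], 0 <= complex.Re c -> row_free ((cx N) - c%:M).

(** On the kernel of Q, the first inclusion makes X z a linear function P of Y z,
    and the second one says that P has no eigenvalue - c with 0 <= Re c. If N is
    Hurwitz and - N extends P to the whole space, then X + N Y vanishes on the
    kernel of Q, hence lies in the row space of Q. *)
Lemma hurwitz_relation (h r w : nat) (Q : 'M[R]_(h, w)) (X Y : 'M[R]_(r, w)) :
  (X <= Q + Y)%MS ->
  (forall c : R[i], 0 <= complex.Re c -> ((cx Y) <= (cx Q) + ((cx X) + c *: (cx Y))%R)%MS) ->
  exists2 N : 'M[R]_r, hurwitz N & ((X + N *m Y)%R <= Q)%MS.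
Proof.
move=> /sub_addsmxP[[D P] /= XE] Ysub.
pose Z := cokermx Q; pose S0 := Y *m Z; pose S1 := X *m Z.
have S1E : S1 = P *m S0.
  by rewrite /S1 XE mulmxDl -!mulmxA mulmx_coker mulmx0 add0r.
have [d [J [U [W [UJ WJ fJ]]]]] := row_free_factor S0^T.
(* The eigenvalue 0 has to be admissible for the extension, so the stability
   region is moved to Re c < 1 by adding the identity. *)
have [||c /= c1|N' JN' stabN'] := @pencil_extension R R[i] (real_complex R)
    (fun c => 1 <= complex.Re c) _ _ J (J - J *m P^T).
- by rewrite /= ler10.
- exact: fJ.
- apply/row_freeP_inj => v v0.
  have c0 : 0 <= complex.Re (c - 1) by rewrite raddfB /= subr_ge0.
  have [[G V] /= YE] := sub_addsmxP (Ysub _ c0).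
  have S0E : (cx S0) = V *m ((cx S1) + (c - 1) *: (cx S0)).
    have QZ : cx Q *m cx Z = 0 by rewrite -map_mxM mulmx_coker map_mx0.
    rewrite [cx S1]map_mxM [cx S0]map_mxM {1}YE mulmxDl -!mulmxA QZ mulmx0 add0r.
    by rewrite mulmxDl -scalemxAl.
  have : v *m (cx J) = 0.
    have key : cx W *m (cx S1 + (c - 1) *: cx S0)^T =
        - (cx (J - J *m P^T) - c *: cx J).
      have -> : (cx S1 + (c - 1) *: cx S0)^T = cx S1^T + (c - 1) *: cx S0^T.
        by apply/matrixP => i j; rewrite !mxE.
      rewrite mulmxDr -scalemxAr -!map_mxM S1E.
      rewrite trmx_mul mulmxA WJ [cx (_ - _)]map_mxB scalerBl scale1r.
      by rewrite !opprB addrCA.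
    rewrite -WJ map_mxM -map_trmx S0E trmx_mul !mulmxA -(mulmxA v) key.
    by rewrite mulmxN v0 oppr0 mul0mx.
  by apply: row_freeP_inj; rewrite row_free_map fJ.
exists (N'^T - 1%:M).
  move=> c c0; rewrite row_free_unit -unitmx_tr -row_free_unit.
  have c1 : 1 <= complex.Re (c + 1) by rewrite raddfD /= lerDr.
  have := stabN' _ c1; congr (is_true (row_free _)).
  by apply/matrixP => i j; rewrite !mxE eq_sym rmorphB rmorph_nat mulrnDl /=; ring.
rewrite submxE mulmxDl -[X *m _]/S1 -[_ *m cokermx Q]mulmxA -[Y *m _]/S0; apply/eqP.
have NS0 : N'^T *m S0 = S0 - P *m S0.
  apply: trmx_inj; rewrite trmx_mul trmxK -UJ -mulmxA JN' mulmxBr mulmxA UJ.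
  by rewrite -trmx_mul; apply/matrixP => i j; rewrite !mxE.
by rewrite mulmxBl mul1mx NS0 S1E [X in _ + X]addrAC subrr add0r subrr.
Qed.

End HurwitzRelation.

(** * Lyapunov functions of Hurwitz matrices *)

Section DotProduct.
Context {R : realFieldType}.

Definition dot {h : nat} (x y : 'cV[R]_h) : R := \sum_i x i 0 * y i 0.

Lemma dotC h (x y : 'cV[R]_h) : dot x y = dot y x.
Proof. by apply: eq_bigr => i _; rewrite mulrC. Qed.

Lemma dot_col_mx h1 h2 (x y : 'cV[R]_h1) (x' y' : 'cV[R]_h2) :
  dot (col_mx x x') (col_mx y y') = dot x y + dot x' y'.
Proof.
rewrite /dot big_split_ord /=; congr (_ + _); apply: eq_bigr => i _.
  by rewrite !col_mxEu.
by rewrite !col_mxEd.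
Qed.

Lemma dotDr h (x y z : 'cV[R]_h) : dot x (y + z) = dot x y + dot x z.
Proof. by rewrite -big_split; apply: eq_bigr => i _; rewrite mxE mulrDr. Qed.

Lemma dotZr h a (x y : 'cV[R]_h) : dot x (a *: y) = a * dot x y.
Proof. by rewrite mulr_sumr; apply: eq_bigr => i _; rewrite mxE mulrCA. Qed.

Lemma dotZl h a (x y : 'cV[R]_h) : dot (a *: x) y = a * dot x y.
Proof. by rewrite dotC dotZr dotC. Qed.

Lemma dot_ge0 h (x : 'cV[R]_h) : 0 <= dot x x.
Proof. by apply: sumr_ge0 => i _; rewrite -expr2 sqr_ge0. Qed.

Lemma dot0l h (x : 'cV[R]_h) : dot 0 x = 0.
Proof. by rewrite /dot big1// => i _; rewrite mxE mul0r. Qed.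

Lemma dot_entry_le h (x : 'cV[R]_h) i : x i 0 ^+ 2 <= dot x x.
Proof.
rewrite /dot (bigD1 i)//= -expr2 lerDl sumr_ge0// => j _.
by rewrite -expr2 sqr_ge0.
Qed.

(** Expand a / 2 * |x - y / a|^2. *)
Lemma dot_young h (a : R) (x y : 'cV[R]_h) : 0 < a ->
  dot x y <= a / 2 * dot x x + (a * 2)^-1 * dot y y.
Proof.
move=> a0; rewrite /dot !mulr_sumr -big_split /=; apply: ler_sum => i _.
rewrite -subr_ge0.
have -> : a / 2 * (x i 0 * x i 0) + (a * 2)^-1 * (y i 0 * y i 0) -
  x i 0 * y i 0 = (a / 2) * (x i 0 - a^-1 * y i 0) ^+ 2.
  by field; rewrite gt_eqF.
by rewrite mulr_ge0 ?sqr_ge0// divr_ge0// ltW.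
Qed.

End DotProduct.

Section Lyapunov.
Context {R : rcfType} {r : nat} (N : 'M[R]_r).
Local Notation C := R[i].
Local Notation "X ^C" := (map_mx (real_complex R) X).
Local Notation ReM := (map_mx (@complex.Re R)).
Local Notation ImM := (map_mx (@complex.Im R)).

Lemma ReIm_mulC a b c (X : 'M[R]_(a, b)) (Y : 'M[C]_(b, c)) :
  ReM (X^C *m Y) = X *m ReM Y /\ ImM (X^C *m Y) = X *m ImM Y.
Proof.
by split; apply/matrixP => i j; rewrite !mxE raddf_sum; apply: eq_bigr => l _;
  rewrite !mxE; case: (Y l j) => u v /=; ring.
Qed.

Lemma ReIm_Cmul a b c (X : 'M[C]_(a, b)) (Y : 'M[R]_(b, c)) :
  ReM (X *m Y^C) = ReM X *m Y /\ ImM (X *m Y^C) = ImM X *m Y.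
Proof.
by split; apply/matrixP => i j; rewrite !mxE raddf_sum; apply: eq_bigr => l _;
  rewrite !mxE; case: (X i l) => u v /=; ring.
Qed.

Lemma ReIm_subZ a b c (X Y : 'M[C]_(a, b)) :
  ReM (X - c *: Y) =
    ReM X - (complex.Re c *: ReM Y - complex.Im c *: ImM Y) /\
  ImM (X - c *: Y) =
    ImM X - (complex.Re c *: ImM Y + complex.Im c *: ReM Y).
Proof.
by split; apply/matrixP => i j; rewrite !mxE; case: c (X i j) (Y i j)
  => [? ?] [? ?] [? ?].
Qed.

(** The Lyapunov function is |S x|^2, of which dot (S x) (S N x) is half the
    derivative along x' = N x. *)
Definition is_lyapunov (a : R) (h : nat) (S : 'M[R]_(h, r)) :=
  (forall x, dot x x <= dot (S *m x) (S *m x)) /\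
  (forall x, dot (S *m x) (S *m (N *m x)) <= - a * dot (S *m x) (S *m x)).

(** For M_0 = M and M_(j+1) = (N - c_j) M_j, the derivative of |M_j x|^2 along
    x' = N x is at most - a |M_j x|^2 + a^-1 |M_(j+1) x|^2, since
    M_j N = c_j M_j + M_(j+1). As the chain ends with 0, a sum of these squares
    with geometrically growing weights decreases exponentially. S stacks the
    weighted real and imaginary parts of the M_j; the extra term g in the second
    inequality is the margin that absorbs the coupling to the preceding link. *)
Lemma lyapunov_chain (a : R) (s : seq C) (M : 'M[C]_r) : 0 < a ->
  (forall c, c \in s -> complex.Re c <= - a) ->
  N^C *m M = M *m N^C ->
  foldl (fun X c => (N^C - c%:M) *m X) M s = 0 ->
  exists (h : nat) (S : 'M[R]_(h, r)), forall x,
    let g := dot (ReM M *m x) (ReM M *m x) + dot (ImM M *m x) (ImM M *m x) in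
    g <= dot (S *m x) (S *m x) /\
    dot (S *m x) (S *m (N *m x)) <= - (a / 4) * (dot (S *m x) (S *m x) + g).
Proof.
move=> a0; elim: s M => [|c s IH] M sa NM /=.
  move=> ->; exists 0, 0 => x /=.
  have [-> ->] : ReM (0 : 'M[C]_r) = 0 /\ ImM (0 : 'M[C]_r) = 0.
    by split; apply/matrixP => i j; rewrite !mxE.
  by rewrite !mul0mx !dot0l !addr0 mulr0.
set M' := (_ - _) *m M => sM'.
have NM' : N^C *m M' = M' *m N^C.
  rewrite /M' mulmxA -[RHS]mulmxA -NM mulmxA; congr (_ *m _).
  by rewrite mulmxBr mulmxBl scalar_mxC.
have {sM'}[d ds|h [S HS]] := IH M' _ NM' sM'.
  by apply: sa; rewrite inE ds orbT.
(* b ^ 2 = 4 / a ^ 2 makes the margin (a / 4) b ^ 2 = a^-1 dominate the coupling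
   coefficient (2 a)^-1 coming from Young's inequality. *)
pose b := 2 / a; have b0 : 0 < b by rewrite divr_gt0.
exists (r + (r + h)), (col_mx (ReM M) (col_mx (ImM M) (b *: S))) => x.
have [ReN ImN] := ReIm_mulC N M; have [ReN' ImN'] := ReIm_Cmul M N.
have M'E : M' = N^C *m M - c *: M by rewrite /M' mulmxBl mul_scalar_mx.
have [ReM' ImM'] := ReIm_subZ c (N^C *m M) M.
rewrite -M'E NM ReN' ImN' in ReM' ImM'.
have {ReM'}ReMN : ReM M *m N =
  ReM M' + (complex.Re c *: ReM M - complex.Im c *: ImM M).
  by rewrite ReM' subrK.
have {ImM'}ImMN : ImM M *m N =
  ImM M' + (complex.Re c *: ImM M + complex.Im c *: ReM M).
  by rewrite ImM' subrK.
rewrite /= !mul_col_mx !dot_col_mx.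
rewrite (mulmxA (ReM M)) (mulmxA (ImM M)) ReMN ImMN.
rewrite !mulmxDl !mulNmx -!scalemxAl -scaleNr !dotDr !dotZl !dotZr.
rewrite (dotC (ImM M *m x) (ReM M *m x)).
have [] := HS x => /=.
have := dot_young (ReM M *m x) (ReM M' *m x) a0.
have := dot_young (ImM M *m x) (ImM M' *m x) a0.
have := dot_ge0 (ReM M *m x); have := dot_ge0 (ImM M *m x).
have := dot_ge0 (ReM M' *m x); have := dot_ge0 (ImM M' *m x).
have := dot_ge0 (S *m x).
set g1 := dot (ReM M *m x) (ReM M *m x).
set g2 := dot (ImM M *m x) (ImM M *m x).
set g1' := dot (ReM M' *m x) (ReM M' *m x).
set g2' := dot (ImM M' *m x) (ImM M' *m x).
set e1 := dot _ (ReM M' *m x); set e2 := dot _ (ImM M' *m x).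
set t := dot (ReM M *m x) (ImM M *m x).
set v := dot (S *m x) (S *m x); set w := dot _ (S *m (N *m x)).
have : complex.Re c <= - a by apply: sa; rewrite inE eqxx.
move: (complex.Re c) (complex.Im c) => al be ala v0 g2'0 g1'0 g20 g10 y2 y1.
move=> gv wv; split.
  by rewrite addrA lerDl (mulr_ge0 (ltW b0) (mulr_ge0 (ltW b0) v0)).
have alg1 : al * g1 <= - a * g1 by apply: ler_wpM2r.
have alg2 : al * g2 <= - a * g2 by apply: ler_wpM2r.
have bw : b * (b * w) <= b * (b * (- (a / 4) * (v + (g1' + g2')))).
  by rewrite !ler_pM2l.
have bE : b * (b * (- (a / 4) * (v + (g1' + g2')))) =
   - (a / 4) * (b * (b * v)) - a^-1 * (g1' + g2').
  by rewrite /b; field; rewrite gt_eqF.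
have aE : (a * 2)^-1 = a^-1 / 2 by field; rewrite gt_eqF.
rewrite aE in y1 y2.
have ag1' : 0 <= a^-1 * g1' by rewrite mulr_ge0// invr_ge0 ltW.
have ag2' : 0 <= a^-1 * g2' by rewrite mulr_ge0// invr_ge0 ltW.
lra.
Qed.

End Lyapunov.

Lemma foldl_horner_mx (k : fieldType) (r : nat) (A : 'M[k]_r.+1) (s : seq k)
    (M : 'M[k]_r.+1) :
  foldl (fun X c => (A - c%:M) *m X) M s =
  horner_mx A (\prod_(c <- s) ('X - c%:P)) *m M.
Proof.
elim: s M => [|c s IH] M /=; first by rewrite big_nil rmorph1 mul1mx.
rewrite IH big_cons mulrC rmorphM /= -mulmxE -mulmxA; congr (_ *m (_ *m _)).
by rewrite rmorphB /= horner_mx_X horner_mx_C.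
Qed.

Lemma seq_Re_bound (R : rcfType) (s : seq R[i]) :
  (forall c, c \in s -> complex.Re c < 0) ->
  exists2 a : R, 0 < a & forall c, c \in s -> complex.Re c <= - a.
Proof.
elim: s => [|c s IH] sn; first by exists 1.
have [|a a0 sa] := IH; first by move=> d ds; apply: sn; rewrite inE ds orbT.
have c0 : complex.Re c < 0 by apply: sn; rewrite inE eqxx.
exists (Num.min a (- complex.Re c)).
  by rewrite lt_min a0 oppr_gt0.
move=> d; rewrite inE lerNr ge_min => /predU1P[->|/sa]; first by rewrite lexx orbT.
by rewrite lerNr => ->.
Qed.

(** By the Cayley-Hamilton theorem, the product of the factors N - c over the
    complex eigenvalues c of N vanishes, so the chain that starts with the
    identity ends with 0. *)
Lemma hurwitz_lyapunov (R : rcfType) (r : nat) (N : 'M[R]_r) :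
  hurwitz N ->
  exists (a : R) (h : nat) (S : 'M[R]_(h, r)), 0 < a /\ is_lyapunov N a S.
Proof.
case: r N => [|r] N Nstab.
  exists 1, 0, 0; split=> //; split=> x; rewrite !mul0mx !dot0l ?mulr0//.
  by rewrite /dot big_ord0.
move: Nstab; rewrite /hurwitz; set NC := map_mx _ N => Nstab.
have [s] := closed_field_poly_normal (char_poly NC).
rewrite (monicP (char_poly_monic _)) scale1r => charE.
have [a a0 sa] : exists2 a : R, 0 < a & forall c, c \in s -> complex.Re c <= - a.
  apply: seq_Re_bound => c cs; rewrite ltNge; apply/negP => /Nstab.
  have : root (char_poly NC) c by rewrite charE root_prod_XsubC.
  rewrite -eigenvalue_root_char => /eigenvalueP[v vN /eqP v0] /row_freeP_inj.
  by move/(_ v) => vK; apply/v0/vK; rewrite mulmxBr vN mul_mx_scalar subrr.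
have [||h [S HS]] := @lyapunov_chain R _ N a s 1%:M a0 sa.
- by rewrite mul1mx mulmx1.
- by rewrite foldl_horner_mx -charE Cayley_Hamilton mul0mx.
have Re1 : map_mx (@complex.Re R) (1%:M : 'M[R[i]]_r.+1) = 1%:M.
  by apply/matrixP => i j; rewrite !mxE; case: eqP.
exists (a / 4), h, S; split; first by rewrite divr_gt0.
split=> x; have [] := HS x => /=; rewrite Re1 mul1mx => H1 H2.
  by apply: le_trans H1; rewrite lerDl dot_ge0.
apply: le_trans H2 _; rewrite mulrDr gerDl mulNr oppr_le0 mulr_ge0//.
  by rewrite divr_ge0// ltW.
by rewrite addr_ge0// dot_ge0.
Qed.

(** * Monotonicity of absolutely continuous functions *)

Section Cousin.
Context {R : realType}.

(** Cousin's lemma in induction form: a property of intervals that is additive and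
    holds for all sufficiently short intervals around each point holds for
    [a, b]. *)
Lemma cousin (P : R -> R -> Prop) (a b : R) : a <= b ->
  (forall x y z, P x y -> P y z -> P x z) ->
  (forall t, a <= t <= b -> exists2 e : R, 0 < e &
     forall x y, a <= x <= t -> t <= y <= b -> t - e < x -> y < t + e -> P x y) ->
  P a b.
Proof.
move=> ab Ptrans Ploc.
pose S := [set x | a <= x <= b /\ P a x].
have aab : a <= a <= b by rewrite lexx.
have Sa : S a.
  split=> //; have [e e0] := Ploc a aab; apply; rewrite ?lexx//.
    by rewrite ltrBlDr ltrDl.
  by rewrite ltrDl.
have ubS : ubound S b by move=> x [/andP[]].
have hsS : has_sup S by split; [exists a | exists b].
pose c := sup S.
have ac : a <= c by apply: ub_le_sup => //; exists b.
have cb : c <= b by apply: ge_sup => //; exists a.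
have [|e e0 Pc] := Ploc c; first by rewrite ac.
have [x [/andP[ax xb] Pax] cex] := sup_adherent e0 hsS.
have xc : x <= c by apply: ub_le_sup; [exists b|split => //; apply/andP].
have Pay y : c <= y <= b -> y < c + e -> P a y.
  by move=> cyb yc; apply: Ptrans Pax _; apply: Pc => //; rewrite ax.
have [cltb|bc] := ltP c b; last first.
  by have <- : c = b; [apply/le_anti; rewrite cb|apply: Pay; rewrite ?lexx ?ltrDl].
pose y := Num.min b (c + e / 2).
have cy : c < y by rewrite lt_min cltb ltrDl divr_gt0.
have yce : y < c + e.
  by rewrite gt_min ltrD2l gtr_pMr// invf_lt1// ltr1n orbT.
have yb : y <= b by rewrite ge_min lexx.
have : y <= c.
  apply: ub_le_sup; first by exists b.
  split; first by rewrite yb andbT (le_trans ac)// ltW.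
  by apply: Pay; rewrite // yb ltW.
by rewrite leNgt cy.
Qed.

End Cousin.

Section Monotone.
Context {R : realType}.
Local Notation mu := (@lebesgue_measure R).

Lemma derive_le0_near (g : R -> R) (t d e : R) :
  is_derive t 1 g d -> d <= 0 -> 0 < e ->
  exists2 r : R, 0 < r & forall x y, x <= t <= y -> t - r < x -> y < t + r ->
    g y - g x <= e * (y - x).
Proof.
move=> [gdv <-] d0 e0.
have : h^-1 *: (g (h *: (1 : R) + t) - g t) @[h --> 0^'] --> 'D_1 g t by [].
move/cvgrPdist_lt => /(_ e e0)[r /= r0 Hr].
exists r => // x y /andP[xt ty] trx ytr.
have gty : g y - g t <= e * (y - t).
  move: ty; rewrite le_eqVlt => /predU1P[->|ty]; first by rewrite !subrr mulr0.
  have yt0 : 0 < y - t by rewrite subr_gt0.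
  have := Hr (y - t); rewrite /ball_/= sub0r normrN gtr0_norm// ltrBlDl.
  move=> /(_ ytr (lt0r_neq0 yt0)); rewrite ltr_distlC => /andP[_].
  rewrite /GRing.scale/= mulr1 subrK => H.
  rewrite -ler_pdivrMr// mulrC; apply: ltW; apply: lt_le_trans H _.
  by rewrite gerDr.
have gxt : g t - g x <= e * (t - x).
  move: xt; rewrite le_eqVlt => /predU1P[->|xt]; first by rewrite !subrr mulr0.
  have xt0 : x - t < 0 by rewrite subr_lt0.
  have := Hr (x - t); rewrite /ball_/= sub0r normrN ltr0_norm// opprB ltrBlDr.
  rewrite -ltrBlDl => /(_ trx (ltr0_neq0 xt0)); rewrite ltr_distlC => /andP[_].
  rewrite /GRing.scale/= mulr1 subrK => H.
  have {}H : (x - t)^-1 * (g x - g t) <= e.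
    by apply: ltW; apply: lt_le_trans H _; rewrite gerDr.
  have {}H : e * (x - t) <= g x - g t by rewrite -ler_ndivrMr// mulrC.
  lra.
lra.
Qed.

(** Split [a, b] into short intervals, each around a tag t. If t is not in the
    exceptional null set Z, the increment of g is at most e times the length of
    the interval, because g'(t) <= 0. The intervals with tags in Z can be kept
    inside an open set U of measure less than del, so absolute continuity bounds
    the sum of their increments. P x y records such a splitting of [x, y]; its
    list s contains the intervals tagged in Z. *)
Lemma AC_nonincreasing (g : R -> R) (a b : R) : AC_loc g ->
  (\forall t \ae mu, a <= t <= b ->
     exists2 d : R, is_derive (t : R) 1 g d & d <= 0) ->
  a <= b -> g b <= g a.
Proof.
move=> ACg [Z [mZ Z0 sZ]] ab.
apply/ler_addgt0Pr => eps eps0.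
pose e := eps / (b - a + 1).
have ba1 : 0 < b - a + 1 by rewrite ltr_wpDl ?subr_ge0.
have e0 : 0 < e by rewrite divr_gt0.
have [del del0 Hdel] := ACg a b e e0.
have muZ : (mu Z < +oo)%E by rewrite Z0.
have [U [oU ZU muU]] := lebesgue_regularity_outer mZ muZ del0.
have mU : measurable U by apply: open_measurable.
have {}muU : (mu U < del%:E)%E.
  have : (mu (Z `|` (U `\` Z)) <= mu Z + mu (U `\` Z))%E.
    by apply: measureU2 => //; exact: measurableD.
  by rewrite Z0 add0e setDUK// => /le_lt_trans; exact.
pose P x y := x <= y /\ exists s : seq (R * R), [/\
  all (fun I => [&& x <= I.1, I.1 <= I.2 & I.2 <= y]) s,
  pairwise (fun I J => (I.2 <= J.1) || (J.2 <= I.1)) s,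
  ((\sum_(I <- s) (I.2 - I.1))%:E <= mu (U `&` `[x, y[%classic))%E &
  g y - g x <= e * (y - x) + \sum_(I <- s) `|g I.2 - g I.1|].
suff [_ [s [s1 s2 s3 s4]]] : P a b.
  have : \sum_(I <- s) `|g I.2 - g I.1| < e.
    apply: Hdel => //; rewrite -lte_fin; apply: le_lt_trans s3 _.
    apply: le_lt_trans muU; apply: le_measure; rewrite ?inE//.
    exact: measurableI.
  have epsE : e * (b - a) + e = eps.
    by rewrite -[X in _ + X]mulr1 -mulrDr /e divfK// gt_eqF.
  lra.
apply: cousin => //.
- move=> x y z [xy [s [s1 s2 s3 s4]]] [yz [s' [s1' s2' s3' s4']]].
  split; first exact: le_trans yz.
  exists (s ++ s'); split.
  + rewrite all_cat; apply/andP; split.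
      apply: sub_all s1 => I /and3P[-> -> /=] /le_trans; exact.
    by apply: sub_all s1' => I /and3P[/(le_trans xy) -> -> ->].
  + rewrite pairwise_cat s2 s2' !andbT; apply/allrelP => I J Is Js.
    have /and3P[_ _ Iy] := allP s1 _ Is; have /and3P[yJ _ _] := allP s1' _ Js.
    by rewrite (le_trans Iy yJ).
  + rewrite big_cat /= EFinD.
    have -> : U `&` `[x, z[ = (U `&` `[x, y[) `|` (U `&` `[y, z[).
      rewrite -setIUr -itv_bndbnd_setU ?bnd_simp//.
    rewrite measureU//; [exact: leeD|exact: measurableI|exact: measurableI|].
    rewrite -subset0 => u [[_ /=]]; rewrite in_itv/= => /andP[_ uy] [_ /=].
    by rewrite in_itv/= leNgt uy.
  + rewrite big_cat /=; lra.
- move=> t tab; have [Zt|nZt] := pselect (Z t).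
  + have /nbhs_ballP[r /= r0 rU] : nbhs t U by apply: open_nbhs_nbhs; split => //; exact: ZU.
    exists r => // x y /andP[ax xt] /andP[ty yb] trx ytr.
    have xy := le_trans xt ty.
    split=> //; exists [:: (x, y)]; rewrite /= !big_seq1 /= !lexx xy; split=> //.
      rewrite setIidr.
        rewrite lebesgue_measure_itv/= lte_fin; case: ltgtP xy => // -> _.
        by rewrite subrr.
      move=> u /=; rewrite in_itv/= => /andP[xu uy]; apply: rU.
      by rewrite /ball/= distrC ltr_distl (lt_le_trans trx xu) (lt_trans uy ytr).
    apply: le_trans (ler_norm _) _; rewrite lerDr mulr_ge0 ?subr_ge0//.
    exact: ltW.
  + have [d gd d0] : exists2 d : R, is_derive (t : R) 1 g d & d <= 0.
      by apply: contrapT => H; apply/nZt/sZ => /(_ tab).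
    have [r r0 Hr] := derive_le0_near gd d0 e0.
    exists r => // x y /andP[ax xt] /andP[ty yb] trx ytr.
    split; first exact: le_trans ty.
    exists [::]; rewrite !big_nil addr0; split => //.
    by apply: Hr => //; apply/andP.
Qed.

End Monotone.

(** * Closure properties of local absolute continuity *)

Section AbsoluteContinuity.
Context {R : realType}.

(** It is enough to bound the increments of h by those of f and g, locally
    uniformly; sums, products, linear images and exponentials are instances. *)
Lemma AC_loc_dominated2 (U V W : normedModType R) (f : R -> U) (g : R -> V)
    (h : R -> W) : AC_loc f -> AC_loc g ->
  (forall a b, exists2 L : R, 0 < L & forall s t, a <= s -> s <= t -> t <= b ->
     `|h t - h s| <= L * (`|f t - f s| + `|g t - g s|)) ->
  AC_loc h.
Proof.
move=> ACf ACg dom a b e e0; have [L L0 HL] := dom a b.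
have e'0 : 0 < e / (L * 2) by rewrite divr_gt0// mulr_gt0.
have [df df0 Hf] := ACf a b _ e'0; have [dg dg0 Hg] := ACg a b _ e'0.
exists (Num.min df dg); first by rewrite lt_min df0.
move=> s s1 s2; rewrite lt_min => /andP[/(Hf _ s1 s2) Sf /(Hg _ s1 s2) Sg].
apply: (@le_lt_trans _ _ (\sum_(I <- s)
    (L * `|f I.2 - f I.1| + L * `|g I.2 - g I.1|))).
  rewrite big_seq [leRHS]big_seq; apply: ler_sum => I Is; rewrite -mulrDr.
  by have /and3P[? ? ?] := allP s1 _ Is; apply: HL.
rewrite big_split /= -!mulr_sumr -mulrDr.
have -> : e = L * (e / (L * 2) + e / (L * 2)) by field; rewrite gt_eqF.
by rewrite ltr_pM2l// ltrD.
Qed.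

Lemma AC_loc_dominated (U W : normedModType R) (f : R -> U) (h : R -> W) :
  AC_loc f -> (exists2 L : R, 0 < L &
    forall s t, `|h t - h s| <= L * `|f t - f s|) -> AC_loc h.
Proof.
move=> ACf [L L0 HL]; apply: (AC_loc_dominated2 ACf ACf) => a b.
exists L => // s t _ _ _; apply: le_trans (HL _ _) _.
by rewrite ler_pM2l// lerDl.
Qed.

Lemma AC_loc_id : AC_loc (id : R -> R).
Proof.
move=> a b e e0; exists e => // s s1 _; congr (_ < _).
rewrite big_seq [RHS]big_seq; apply: eq_bigr => I Is.
by have /and3P[_ ? _] := allP s1 _ Is; rewrite ger0_norm// subr_ge0.
Qed.

Lemma AC_loc_cst (V : normedModType R) (x : V) : AC_loc (fun=> x).
Proof.
by move=> a b e e0; exists 1 => // s _ _ _; rewrite big1// => I _; rewrite subrr normr0.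
Qed.

Lemma AC_locD (V : normedModType R) (f g : R -> V) :
  AC_loc f -> AC_loc g -> AC_loc (fun t => f t + g t).
Proof.
move=> ACf ACg; apply: (AC_loc_dominated2 ACf ACg) => a b; exists 1 => // s t _ _ _.
by rewrite mul1r opprD addrACA ler_normD.
Qed.

Lemma AC_locN (V : normedModType R) (f : R -> V) :
  AC_loc f -> AC_loc (fun t => - f t).
Proof.
move=> ACf; apply: (AC_loc_dominated ACf); exists 1 => // s t.
by rewrite mul1r opprK -normrN opprD opprK.
Qed.

Lemma AC_loc_sum (I : Type) (s : seq I) (V : normedModType R) (f : I -> R -> V) :
  (forall i, AC_loc (f i)) -> AC_loc (fun t => \sum_(i <- s) f i t).
Proof.
move=> ACf; elim: s => [|i s IH].
  rewrite (_ : (fun _ => _) = cst 0); first exact: AC_loc_cst.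
  by apply/funext => t; rewrite big_nil.
rewrite (_ : (fun _ => _) = (fun t => f i t + \sum_(j <- s) f j t)).
  exact: AC_locD.
by apply/funext => t; rewrite big_cons.
Qed.

Lemma AC_loc_continuous (V : normedModType R) (f : R -> V) :
  AC_loc f -> continuous f.
Proof.
move=> ACf t; apply/cvgrPdist_lt => e e0.
have [d d0 Hd] := ACf (t - 1) (t + 1) e e0.
have m0 : 0 < Num.min d 1 by rewrite lt_min d0 ltr01.
apply: filterS (nbhsx_ballx t _ m0) => u; rewrite /ball/= lt_min => /andP[tud]; rewrite ltr_distlC => /andP[tu ut].
have [tleu|ultt] := lerP t u.
  have := Hd [:: (t, u)]; rewrite /= !big_seq1 /= andbT distrC; apply => //.
    by apply/and3P; split; lra.
  by move: tud; rewrite ler0_norm ?subr_le0// opprB.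
have := Hd [:: (u, t)]; rewrite /= !big_seq1 /= andbT; apply => //.
  by apply/and3P; split; lra.
by move: tud; rewrite gtr0_norm ?subr_gt0.
Qed.

Lemma AC_loc_bounded (f : R -> R) (a b : R) : AC_loc f ->
  exists2 B : R, 0 < B & forall t, a <= t <= b -> `|f t| <= B.
Proof.
move=> /AC_loc_continuous cf; have [ab|ba] := leP a b; last first.
  exists 1 => // t /andP[/le_trans at_ /at_]; by rewrite leNgt ba.
have [|c _ Hc] := @EVT_max R (fun t => `|f t|) a b ab.
  apply: continuous_subspaceT => t.
  by apply: (@continuous_comp _ _ _ f); [exact: cf|exact: norm_continuous].
exists (`|f c| + 1); first by rewrite ltr_wpDl.
by move=> t tab; rewrite (le_trans (Hc t _))// lerDl.
Qed.

Lemma AC_locM (f g : R -> R) :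
  AC_loc f -> AC_loc g -> AC_loc (fun t => f t * g t).
Proof.
move=> ACf ACg; apply: (AC_loc_dominated2 ACf ACg) => a b.
have [Bf Bf0 HBf] := AC_loc_bounded a b ACf.
have [Bg Bg0 HBg] := AC_loc_bounded a b ACg.
exists (Bf + Bg); first exact: addr_gt0.
move=> s t as_ st tb.
have -> : f t * g t - f s * g s = (f t - f s) * g t + f s * (g t - g s) by ring.
apply: le_trans (ler_normD _ _) _; rewrite !normrM mulrDr lerD//.
  have gB : `|g t| <= Bg by apply: HBg; rewrite tb (le_trans as_).
  by rewrite mulrC ler_wpM2r// (le_trans gB)// lerDr ltW.
have fB : `|f s| <= Bf by apply: HBf; rewrite as_ (le_trans st).
by rewrite ler_wpM2r// (le_trans fB)// lerDl ltW.
Qed.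

Lemma AC_loc_expR (c : R) : AC_loc (fun t => expR (c * t)).
Proof.
(* convexity: the graph of expR lies above its tangents *)
have expR_sub (x y : R) : expR x - expR y <= expR x * (x - y).
  have := expR_ge1Dx (y - x); rewrite -(ler_pM2l (expR_gt0 x)) -expRD.
  by rewrite subrKC; lra.
apply: (AC_loc_dominated2 AC_loc_id AC_loc_id) => a b.
pose B := `|c| * (`|a| + `|b|).
exists (expR B * (`|c| + 1)); first by rewrite mulr_gt0 ?expR_gt0// ltr_wpDl.
move=> s t as_ st tb.
have cB u : a <= u -> u <= b -> c * u <= B.
  move=> au ub; apply: le_trans (ler_norm _) _; rewrite normrM ler_wpM2l//.
  rewrite ler_norml; apply/andP; split.
    by have := ler_normr (- a) `|a|; have := ler_norm (- a); rewrite normrN; have := normr_ge0 b; lra.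
  by have := ler_norm b; have := normr_ge0 a; lra.
have expB u : a <= u -> u <= b -> expR (c * u) <= expR B.
  by move=> au ub; rewrite ler_expR cB.
have key x y : a <= x <= b -> expR (c * x) - expR (c * y) <=
    expR B * (`|c| * `|x - y|).
  move=> /andP[ax xb]; apply: le_trans (expR_sub _ _) _.
  apply: (@le_trans _ _ (expR (c * x) * (`|c| * `|x - y|))).
    by rewrite ler_pM2l ?expR_gt0// -normrM -mulrBr ler_norm.
  by rewrite ler_wpM2r ?expB// mulr_ge0.
have le1 : expR B * (`|c| * `|t - s|) <=
    expR B * (`|c| + 1) * (`|t - s| + `|t - s|).
  rewrite -mulrA ler_pM2l ?expR_gt0//.
  by have := normr_ge0 c; have := normr_ge0 (t - s); nra.
apply: le_trans le1; rewrite ler_norml; apply/andP; split.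
  by rewrite lerNl opprB distrC key// as_ (le_trans st).
by rewrite key// tb (le_trans as_).
Qed.

Lemma mx_entry_le (a b : nat) (X : 'M[R]_(a, b)) i j : `|X i j| <= `|X|.
Proof. by rewrite [leRHS]/Num.norm/= mx_normrE (le_bigmax _ _ (i, j)). Qed.

Lemma mx_norm_le (a b : nat) (X : 'M[R]_(a, b)) (c : R) : 0 <= c ->
  (forall i j, `|X i j| <= c) -> `|X| <= c.
Proof. by move=> c0 Xc; rewrite /Num.norm/= mx_normrE bigmax_le. Qed.

Lemma AC_loc_entry (a b : nat) (f : R -> 'M[R]_(a, b)) i j :
  AC_loc f -> AC_loc (fun t => f t i j).
Proof.
move=> ACf; apply: (AC_loc_dominated ACf); exists 1 => // s t; rewrite mul1r.
by apply: le_trans (mx_entry_le _ i j); rewrite !mxE.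
Qed.

Lemma AC_loc_mulmx (a b c : nat) (L : 'M[R]_(a, b)) (f : R -> 'M[R]_(b, c)) :
  AC_loc f -> AC_loc (fun t => L *m f t).
Proof.
move=> ACf; apply: (AC_loc_dominated ACf).
exists (1 + \sum_i \sum_j `|L i j|).
  by rewrite ltr_pwDl// sumr_ge0// => i _; apply: sumr_ge0.
move=> s t; rewrite -mulmxBr mulrDl mul1r mulr_suml.
apply: mx_norm_le => [|i j].
  by rewrite addr_ge0// sumr_ge0// => i _; rewrite mulr_ge0// sumr_ge0.
rewrite mxE (le_trans (ler_norm_sum _ _ _))// (bigD1 i)//= addrCA ler_wpDr//.
  by rewrite addr_ge0// sumr_ge0// => k _; rewrite mulr_ge0// sumr_ge0.
by rewrite mulr_suml ler_sum// => k _; rewrite normrM ler_wpM2l// mx_entry_le.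
Qed.

Lemma AC_loc_dot (h : nat) (f g : R -> 'cV[R]_h) :
  AC_loc f -> AC_loc g -> AC_loc (fun t => dot (f t) (g t)).
Proof.
by move=> ACf ACg; apply: AC_loc_sum => i; apply: AC_locM; exact: AC_loc_entry.
Qed.

End AbsoluteContinuity.

(** * Derivatives of matrix-valued functions *)

Section Derivatives.
Context {R : realType}.

Lemma is_derive_mxP (a b : nat) (f : R -> 'M[R]_(a, b)) (t : R) D :
  is_derive t 1 f D <-> forall i j, is_derive t 1 (fun s => f s i j) (D i j).
Proof.
split=> [[df <-] i j|H].
  by split; [exact: (derivable_mxP _ _ _).1 | rewrite derive_mx// mxE].
have df : derivable f t 1 by apply/derivable_mxP => i j; case: (H i j).
split=> //; rewrite derive_mx//; apply/matrixP => i j; rewrite mxE.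
by case: (H i j).
Qed.

Lemma is_derive_mulmx (a b c : nat) (L : 'M[R]_(a, b)) (f : R -> 'M[R]_(b, c))
    (t : R) D : is_derive t 1 f D -> is_derive t 1 (fun s => L *m f s) (L *m D).
Proof.
move=> /is_derive_mxP df; apply/is_derive_mxP => i j; rewrite mxE.
under eq_fun do rewrite mxE.
rewrite (_ : (fun s => _) = \sum_k (L i k *: (fun s => f s k j))); last first.
  by apply/funext => s; rewrite fct_sumE.
by apply: is_derive_sum => k; apply: is_deriveZ.
Qed.

Lemma is_derive_dot (h : nat) (f g : R -> 'cV[R]_h) (t : R) Df Dg :
  is_derive t 1 f Df -> is_derive t 1 g Dg ->
  is_derive t 1 (fun s => dot (f s) (g s)) (dot (f t) Dg + dot (g t) Df).
Proof.
move=> /is_derive_mxP df /is_derive_mxP dg.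
rewrite (_ : (fun s => _) = \sum_k ((fun s => f s k 0) * (fun s => g s k 0)));
  last by apply/funext => s; rewrite fct_sumE.
rewrite -big_split /=; apply: is_derive_sum => k.
have fk := df k 0; have gk := dg k 0.
by apply: (is_derive_eq (is_deriveM _ _)).
Qed.

End Derivatives.

(** * Autonomous linear equations that hold almost everywhere *)

Section LinearODE.
Context {R : realType}.
Local Notation mu := (@lebesgue_measure R).

Lemma ae_imp (P Q : R -> Prop) : (forall t, P t -> Q t) ->
  (\forall t \ae mu, P t) -> \forall t \ae mu, Q t.
Proof.
move=> PQ; apply: (@filterS _ _ (ae_filter_ringOfSetsType mu) P Q).
by [].
Qed.

Lemma ae_between (P : R -> Prop) (a b : R) : (\forall t \ae mu, P t) ->
  a < b -> exists2 t, a < t < b & P t.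
Proof.
move=> [Z [mZ Z0 sZ]] ab; apply: contrapT => nP.
have abZ : `]a, b[%classic `<=` Z.
  move=> t /=; rewrite in_itv /= => tab; apply: sZ => Pt.
  by apply: nP; exists t.
have : (mu `]a, b[%classic <= mu Z)%E by apply: le_measure; rewrite ?inE.
rewrite Z0 lebesgue_measure_itv /= lte_fin ab -EFinB lee_fin.
by rewrite leNgt subr_gt0 ab.
Qed.

Lemma ae0_continuous_eq0 (V : normedModType R) (f : R -> V) : continuous f ->
  (\forall t \ae mu, f t = 0) -> forall t, f t = 0.
Proof.
move=> cf f0 t; apply/eqP; rewrite -normr_le0; apply/ler_addgt0Pr => e e0.
have /cvgrPdist_lt/(_ e e0)/nbhs_ballP[d /= d0 Hd] := cf t.
have [|s /andP[ts sd] fs0] := @ae_between _ t (t + d) f0; first by rewrite ltrDl.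
have := Hd s; rewrite fs0 subr0 add0r => H; apply/ltW/H.
by rewrite /ball /= ltr_distlC (lt_trans _ ts) ?ltrBlDr ?ltrDl.
Qed.

Lemma is_derive_mull (c u : R) : is_derive u 1 (fun s => c * s) c.
Proof.
apply: (is_derive_eq (@is_deriveZ _ _ _ id c u 1 1 (is_derive_id _ _))).
by rewrite /GRing.scale/= mulr1.
Qed.

Section Solution.
Context {r : nat} (N : 'M[R]_r) (e : R -> 'cV[R]_r).
Hypothesis ACe : AC_loc e.
Hypothesis de : \forall t \ae mu, is_derive (t : R) 1 e (N *m e t).

Lemma dot_norm_le (x : 'cV[R]_r) (c : R) : 0 <= c -> dot x x <= c ^+ 2 ->
  `|x| <= c.
Proof.
move=> c0 xc; apply: mx_norm_le => // i j; rewrite ord1.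
rewrite -(ler_pXn2r (n := 2)) ?nnegrE// real_normK ?num_real//.
exact: le_trans (dot_entry_le _ _) xc.
Qed.

(** V = |S e|^2 is nonincreasing, and as long as V >= eps^2 it decreases at least
    at the constant speed k = 2 a eps^2. Since V >= 0, this ends before time
    V 0 / k. *)
Lemma lyapunov_decay (a : R) (h : nat) (S : 'M[R]_(h, r)) :
  0 < a -> is_lyapunov N a S ->
  forall eps : R, 0 < eps -> exists T : R, forall t, T <= t -> `|e t| <= eps.
Proof.
move=> a0 [Spos Sdec] eps eps0.
pose V t := dot (S *m e t) (S *m e t).
have ACS : AC_loc (fun t => S *m e t) by exact: AC_loc_mulmx.
have ACV : AC_loc V by exact: AC_loc_dot.
have dV : \forall t \ae mu,
    is_derive (t : R) 1 V (dot (S *m e t) (S *m (N *m e t)) *+ 2).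
  apply: ae_imp de => t det; have dS := is_derive_mulmx S det.
  by rewrite mulr2n; exact: is_derive_dot.
have V0 t : 0 <= V t by exact: dot_ge0.
have dVle t : dot (S *m e t) (S *m (N *m e t)) *+ 2 <= - (a * V t) *+ 2.
  by rewrite lerMn2r/= -mulNr Sdec.
have Vnoninc s t : s <= t -> V t <= V s.
  apply: AC_nonincreasing ACV _; apply: ae_imp dV => u dVu _.
  exists (dot (S *m e u) (S *m (N *m e u)) *+ 2) => //.
  by rewrite (le_trans (dVle u))// mulNrn oppr_le0 mulrn_wge0// mulr_ge0// ltW.
pose k := (a * eps ^+ 2) *+ 2.
have k0 : 0 < k by rewrite mulrn_wgt0// mulr_gt0// exprn_gt0.
exists (V 0 / k + 1) => t tT.
have t0 : 0 <= t.
  by apply: le_trans tT; rewrite addr_ge0// divr_ge0// ltW.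
apply: dot_norm_le; first exact: ltW.
apply: le_trans (Spos _) _; rewrite -/(V t) leNgt; apply/negP => Vt.
have : V t + k * t <= V 0 + k * 0.
  apply: (@AC_nonincreasing R (fun s => V s + k * s)) => //.
    apply: AC_locD => //; apply: AC_locM; [exact: AC_loc_cst|exact: AC_loc_id].
  apply: ae_imp dV => u dVu /andP[_ ut].
  exists (dot (S *m e u) (S *m (N *m e u)) *+ 2 + k).
    by have := is_derive_mull k u; exact: is_deriveD.
  have := dVle u; have := Vnoninc _ _ ut; rewrite /k !mulr2n => H1 H2.
  have : a * eps ^+ 2 < a * V u by rewrite ltr_pM2l// (lt_le_trans Vt).
  lra.
rewrite mulr0 addr0.
have : V 0 + k <= k * t.
  by rewrite -ler_pdivrMl// mulrDr mulrC mulVf ?gt_eqF.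
by have := V0 t; lra.
Qed.

Lemma dot_mulmx_bound : exists2 k : R, 0 <= k &
  forall x : 'cV[R]_r, `|dot x (N *m x)| <= k * dot x x.
Proof.
exists (\sum_i \sum_j `|N i j|).
  by rewrite sumr_ge0// => i _; rewrite sumr_ge0.
move=> x; rewrite {1}/dot mulr_suml (le_trans (ler_norm_sum _ _ _))//.
apply: ler_sum => i _; rewrite mxE mulr_sumr mulr_suml.
apply: le_trans (ler_norm_sum _ _ _) _; apply: ler_sum => j _.
rewrite mulrCA normrM ler_wpM2l//.
have := dot_entry_le x i; have := dot_entry_le x j.
have := sqr_ge0 (x i 0 - x j 0); have := sqr_ge0 (x i 0 + x j 0).
by rewrite ler_norml => *; apply/andP; split; nra.
Qed.

(** Gronwall: W = |e|^2 satisfies |W'| <= 2 k W, so expR (- 2 k t) W is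
    nonincreasing and expR (2 k t) W is nondecreasing. The first fact gives W = 0
    after time 0, the second one before. *)
Lemma linear_ode_unique : e 0 = 0 -> forall t, e t = 0.
Proof.
move=> e00 t; have [k k0 Hk] := dot_mulmx_bound.
pose W t := dot (e t) (e t).
have W0 : W 0 = 0 by rewrite /W e00 dot0l.
have ACW : AC_loc W by exact: AC_loc_dot.
(* s = 1 and s = -1 are the two monotonicity statements. *)
have noninc (s : R) : s ^+ 2 = 1 -> forall x y, x <= y ->
    s * (expR (- (s * k *+ 2) * y) * W y) <= s * (expR (- (s * k *+ 2) * x) * W x).
  move=> s1 x y; set c := - _.
  apply: (@AC_nonincreasing R (fun u => s * (expR (c * u) * W u))).
    apply: AC_locM; first exact: AC_loc_cst.
    by apply: AC_locM => //; exact: AC_loc_expR.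
  apply: ae_imp de => u deu _.
  have dWu : is_derive u 1 W (dot (e u) (N *m e u) *+ 2).
    by rewrite mulr2n; exact: is_derive_dot.
  exists (s * (expR (c * u) * (dot (e u) (N *m e u) *+ 2 + c * W u))).
    have dE : is_derive u 1 (fun u => expR (c * u)) (c * expR (c * u)).
      have dc := is_derive_mull c u.
      by rewrite mulrC; exact: is_derive1_comp.
    have dM := is_deriveM dE dWu.
    apply: (is_derive_eq (@is_deriveZ _ _ _ _ s u 1 _ dM)).
    by rewrite /GRing.scale/=; ring.
  rewrite mulrCA pmulr_rle0 ?expR_gt0// /c.
  have := Hk (e u); rewrite ler_norml -/(W u) => /andP[H1 H2].
  have -> : s * (dot (e u) (N *m e u) *+ 2 + - (s * k *+ 2) * W u) =
      (s * dot (e u) (N *m e u) - s ^+ 2 * (k * W u)) *+ 2 by ring.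
  rewrite s1 mul1r mulrn_wle0// subr_le0.
  have : (s - 1) * (s + 1) = 0 by rewrite -subr_sqr s1 expr1n subrr.
  by move/eqP; rewrite mulf_eq0 => /orP[]/eqP ?; [have -> : s = 1 by lra|
    have -> : s = -1 by lra]; lra.
suff : `|e t| <= 0 by rewrite normr_le0 => /eqP.
apply: dot_norm_le => //; rewrite expr0n /= -/(W t).
have [t0|t0] := leP 0 t.
  have := noninc 1 (expr1n _ _) _ _ t0.
  by rewrite W0 !mulr0 !mul1r pmulr_rle0 ?expR_gt0.
have := noninc (-1) _ _ _ (ltW t0); rewrite sqrrN expr1n => /(_ erefl).
by rewrite W0 !mulr0 !mulN1r oppr_ge0 pmulr_rle0 ?expR_gt0.
Qed.

End Solution.

End LinearODE.

(** * Row spaces of the block matrices *)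

Section BlockRows.
Context {k : fieldType} {m n l p r : nat}.
Variables (E A : 'M[k]_(m, n)) (B : 'M[k]_(m, l)).
Variables (C : 'M[k]_(p, n)) (K : 'M[k]_(r, n)).

Local Notation wd := (\sum_(j < n) (n + l) + (n + n))%N.

(** In a kernel vector with blocks (xi_0, ..., xi_(n-1), a, b), the block a stands
    for the derivative of x and - b for x, under zero input and output, while the
    xi_i witness that a is consistent with the hidden constraints. *)
Definition outputs_mx :=
  col_mx (row_mx3 (bidiagF E A B) (calA A) 0)
 (col_mx (row_mx3 0 E A) (col_mx (row_mx3 0 C 0) (row_mx3 0 0 C))).

Definition Kdot : 'M[k]_(r, wd) := row_mx3 0 K 0.
Definition Kval : 'M[k]_(r, wd) := row_mx3 0 0 K.

Lemma outputs_mx_sub (h : nat) (X : 'M[k]_(h, wd)) :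
  (outputs_mx <= X)%MS =
  [&& (row_mx3 (bidiagF E A B) (calA A) 0 <= X)%MS, (row_mx3 0 E A <= X)%MS,
      (row_mx3 0 C 0 <= X)%MS & (row_mx3 0 0 C <= X)%MS].
Proof. by rewrite !col_mx_sub. Qed.

Lemma Gamma_rowspace : (Gamma E A B C K :=: outputs_mx + Kval)%MS.
Proof.
have eqsub h (X : 'M[k]_(h, wd)) :
    (Gamma E A B C K <= X)%MS = (outputs_mx + Kval <= X)%MS.
  by rewrite addsmx_sub outputs_mx_sub !col_mx_sub -!andbA.
by apply/eqmxP/andP; split; [rewrite eqsub|rewrite -eqsub].
Qed.

Lemma Psi_rowspace : (Psi E A B C K :=: outputs_mx + Kval + Kdot)%MS.
Proof.
have eqsub h (X : 'M[k]_(h, wd)) :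
    (Psi E A B C K <= X)%MS = (outputs_mx + Kval + Kdot <= X)%MS.
  by rewrite !addsmx_sub outputs_mx_sub !col_mx_sub -!andbA.
by apply/eqmxP/andP; split; [rewrite eqsub|rewrite -eqsub].
Qed.

Lemma Omega_at_rowspace c :
  (Omega_at E A B C K c :=: outputs_mx + (Kdot + c *: Kval)%R)%MS.
Proof.
have KE : (Kdot + c *: Kval)%R = row_mx3 0 K (c *: K).
  by rewrite /Kdot /Kval /row_mx3 !scale_row_mx !add_row_mx !scaler0 !addr0 add0r.
have eqsub h (X : 'M[k]_(h, wd)) : (Omega_at E A B C K c <= X)%MS =
    (outputs_mx + (Kdot + c *: Kval)%R <= X)%MS.
  by rewrite addsmx_sub outputs_mx_sub KE !col_mx_sub -!andbA.
by apply/eqmxP/andP; split; [rewrite eqsub|rewrite -eqsub].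
Qed.

(** Psi is Gamma with the rows Kdot appended, so equal ranks mean that they bring
    nothing new. *)
Lemma Kdot_sub : \rank (Psi E A B C K) = \rank (Gamma E A B C K) ->
  (Kdot <= outputs_mx + Kval)%MS.
Proof.
rewrite Psi_rowspace Gamma_rowspace => /eqP; rewrite eq_sym.
rewrite (mxrank_leqif_sup (addsmxSl _ _)) => /(submx_trans _); apply.
exact: addsmxSr.
Qed.

(** Here the rows of Omega lie in the row space of Gamma, so equality of the ranks
    means equality of the row spaces. *)
Lemma Kval_sub c : (Kdot <= outputs_mx + Kval)%MS ->
  \rank (Omega_at E A B C K c) = \rank (Gamma E A B C K) ->
  (Kval <= outputs_mx + (Kdot + c *: Kval)%R)%MS.
Proof.
move=> Ksub; rewrite Omega_at_rowspace Gamma_rowspace => /eqP.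
have sub : (outputs_mx + (Kdot + c *: Kval)%R <= outputs_mx + Kval)%MS.
  rewrite addsmx_sub addsmxSl addmx_sub// (submx_trans _ (addsmxSr _ _))//.
  by rewrite scalemx_sub.
rewrite (mxrank_leqif_sup sub); apply: submx_trans.
exact: addsmxSr.
Qed.

Lemma outputs_subP (s : nat) (X Y : 'M[k]_(s, n)) :
  (row_mx3 0 X Y <= outputs_mx)%MS ->
  exists (L1 : 'M[k]_(s, \sum_(i < n) m)) (L2 : 'M[k]_(s, m)) (L3 L4 : 'M[k]_(s, p)),
    [/\ L1 *m bidiagF E A B = 0, X = L1 *m calA A + L2 *m E + L3 *m C &
        Y = L2 *m A + L4 *m C].
Proof.
case/submxP=> D.
rewrite -[D]hsubmxK -[rsubmx D]hsubmxK -[rsubmx (rsubmx D)]hsubmxK.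
set L1 := lsubmx D; set L2 := lsubmx (rsubmx D).
set L3 := lsubmx _; set L4 := rsubmx _.
rewrite /outputs_mx /row_mx3 !mul_row_col !mul_mx_row !add_row_mx.
rewrite !mulmx0 !addr0 !add0r.
move=> /eq_row_mx[L1F /eq_row_mx[XE YE]].
by exists L1, L2, L3, L4; split; rewrite ?XE ?YE ?addrA.
Qed.

End BlockRows.

Lemma map_outputs_mx (k k' : fieldType) (f : {rmorphism k -> k'})
    (m n l p : nat) (E A : 'M[k]_(m, n)) (B : 'M[k]_(m, l)) (C : 'M[k]_(p, n)) :
  map_mx f (outputs_mx E A B C) =
  outputs_mx (map_mx f E) (map_mx f A) (map_mx f B) (map_mx f C).
Proof.
have FE : map_mx f (bidiagF E A B) =
    bidiagF (map_mx f E) (map_mx f A) (map_mx f B).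
  apply/matrixP => i j; rewrite /bidiagF mxE [in LHS]mxE [RHS]mxE.
  case: ifP => _; first by rewrite /scrE -(map_mx0 f) -map_row_mx [RHS]mxE.
  by case: ifP => _; [rewrite /scrA -map_row_mx|rewrite -(map_mx0 f)];
    rewrite [RHS]mxE.
have AE : map_mx f (calA A) = calA (map_mx f A).
  apply/matrixP => i j; rewrite /calA mxE [in LHS]mxE [RHS]mxE.
  by case: ifP => _; rewrite -?(map_mx0 f) [RHS]mxE.
by rewrite /outputs_mx /row_mx3 !map_col_mx !map_row_mx !map_mx0 FE AE.
Qed.

Section Chain.
Context {k : fieldType} {m n l r : nat}.
Variables (E A : 'M[k]_(m, n)) (B : 'M[k]_(m, l)).

Lemma bidiagF_ker (L : 'M[k]_(r, \sum_(i < n) m)) (g := submxrow L) :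
  L *m bidiagF E A B = 0 ->
  (forall i : 'I_n, i = 0%N :> nat -> g i *m E = 0) /\
  (forall i j : 'I_n, j = i.+1 :> nat ->
     g j *m E + g i *m A = 0 /\ g i *m B = 0).
Proof.
rewrite -{1}[L]submxrowK mul_mxrow_mxblock -mxrow0.
move/eq_mxrowP => LF.
have {}LF (j : 'I_n) : (\sum_(i < n) g i *m (if j == i :> nat then scrE E else 0) +
    \sum_(i < n) g i *m (if j == i.+1 :> nat then scrA A B else 0)) = 0.
  rewrite -[RHS](LF j) -big_split; apply: eq_bigr => i _ /=.
  case: eqP => [->|_]; last by rewrite mulmx0 add0r.
  by rewrite ltn_eqF// mulmx0 addr0.
pose sE : 'M[k]_(m, n + l) := scrE E.
have gE (j : 'I_n) : (\sum_(i < n) g i *m (if j == i :> nat then sE else 0)) = g j *m sE.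
  rewrite (bigD1 j)//= eqxx big1 ?addr0// => i ij.
  by rewrite eq_sym (negPf (ij : (i != j :> nat))) mulmx0.
have gA (i j : 'I_n) : j = i.+1 :> nat ->
   (\sum_(i < n) g i *m (if j == i.+1 :> nat then scrA A B else 0)) =
   g i *m scrA A B.
  move=> ji; rewrite (bigD1 i)//= ji eqxx big1 ?addr0// => h hi.
  by rewrite eqSS eq_sym (negPf (hi : (h != i :> nat))) mulmx0.
split=> [j j0|i j ji].
  move: (LF j); rewrite gE big1 ?addr0 => [|i _]; last by rewrite j0 mulmx0.
  by rewrite mul_mx_row -row_mx0 => /eq_row_mx[].
move: (LF j); rewrite gE (gA i)// !mul_mx_row add_row_mx mulmx0 add0r.
by rewrite -row_mx0 => /eq_row_mx[].
Qed.

Lemma mul_calA (L : 'M[k]_(r, \sum_(i < n) m)) (i : 'I_n) :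
  i.+1 = n -> L *m calA A = submxrow L i *m A.
Proof.
move=> iE; rewrite -[L in LHS]submxrowK mul_mxrow_mxcol (bigD1 i)//= iE eqxx.
rewrite big1 ?addr0// => j ji; case: eqP => [jE|]; last by rewrite mulmx0.
by case/eqP: ji; apply: val_inj; apply: succn_inj; rewrite jE iE.
Qed.

End Chain.

(** * Trajectories and the observer *)

Section Observer.
Context {R : realType}.
Local Notation mu := (@lebesgue_measure R).

Lemma ae_imp2 (P Q S : R -> Prop) : (forall t, P t -> Q t -> S t) ->
  (\forall t \ae mu, P t) -> (\forall t \ae mu, Q t) -> \forall t \ae mu, S t.
Proof.
move=> PQS; apply: (@filterS2 _ _ (ae_filter_ringOfSetsType mu) P Q S).
by [].
Qed.

(** The decaying representative e bounds every essential supremum of f. *)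
Lemma ess_cvg0_of_cvg0 (d : nat) (f e : R -> 'cV[R]_d) :
  (\forall t \ae mu, f t = e t) ->
  (forall eps : R, 0 < eps -> exists T : R, forall t, T <= t -> `|e t| <= eps) ->
  ess_cvg0 f.
Proof.
move=> fe e0; rewrite /ess_cvg0.
pose g (t : R) := ess_sup mu ((fun s => `|f s|%:E) \_ `[t, +oo[%classic).
have muT : (0 < mu [set: R])%E.
  by rewrite -set_itvNyy lebesgue_measure_itv /= ?ltNyy ?ltry.
have g0 t : (0 <= g t)%E.
  apply: ess_sup_gee => //; apply: nearW => s; rewrite patchE; case: ifP => // _.
have gle (eps : R) : 0 < eps -> exists T : R, forall t, T <= t -> (g t <= eps%:E)%E.
  move=> eps0; have [T HT] := e0 eps eps0; exists T => t Tt.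
  apply/ess_supP; apply: ae_imp fe => s fes; rewrite patchE.
  case: ifPn => [|_]; last by rewrite lee_fin ltW.
  rewrite inE /= in_itv /= andbT => ts.
  by rewrite lee_fin fes HT// (le_trans Tt).
apply/fine_cvgP; split.
  have [T HT] := gle 1 ltr01; exists T; split; first exact: num_real.
  move=> t /ltW /HT gt1; rewrite ge0_fin_numE ?g0//.
  exact: le_lt_trans gt1 (ltry _).
apply/cvgrPdist_le => eps eps0; have [T HT] := gle eps eps0.
exists T; split; first exact: num_real.
move=> t /ltW /HT gt1 /=; rewrite sub0r normrN ger0_norm ?fine_ge0 ?g0//.
rewrite -lee_fin fineK// ge0_fin_numE ?g0//.
exact: le_lt_trans gt1 (ltry _).
Qed.

Section Functional.
Context {m n l p r : nat}.
Variables (E A : 'M[R]_(m, n)) (B : 'M[R]_(m, l)).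
Variables (C : 'M[R]_(p, n)) (K : 'M[R]_(r, n)).

Section Trajectory.
Variables (x : R -> 'cV[R]_n) (u : R -> 'cV[R]_l) (v : R -> 'cV[R]_m).
Hypothesis ACv : AC_loc v.
Hypothesis Ev : \forall t \ae mu, E *m x t = v t.
Hypothesis dv : \forall t \ae mu, is_derive (t : R) 1 v (A *m x t + B *m u t).

Lemma constraint_derivative (q : nat) (G : 'M[R]_(q, m)) :
  (forall t, G *m v t = 0) ->
  \forall t \ae mu, G *m (A *m x t + B *m u t) = 0.
Proof.
move=> Gv; apply: ae_imp dv => t dvt.
have [_ <-] := is_derive_mulmx G dvt.
rewrite (_ : (fun s => _) = cst 0) ?derive_cst//.
by apply/funext => s; rewrite Gv.
Qed.

(** The blocks g_i of L satisfy g_0 E = 0, g_(i+1) E = - g_i A and g_i B = 0 for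
    all but the last i. So g_0 v = 0; and g_i v = 0 implies
    g_i (A x + B u) = 0, hence g_i A x = 0, hence g_(i+1) v = 0. Only v is ever
    differentiated. *)
Lemma hidden_constraints (q : nat) (L : 'M[R]_(q, \sum_(i < n) m)) (k : 'I_n) :
  L *m bidiagF E A B = 0 ->
  \forall t \ae mu, submxrow L k *m (A *m x t + B *m u t) = 0.
Proof.
move=> /bidiagF_ker[]; set g := submxrow L => g0 gS.
have gv_ae (i : 'I_n) : (\forall t \ae mu, g i *m v t = 0) ->
    forall t, g i *m v t = 0.
  by apply: ae0_continuous_eq0; apply: AC_loc_continuous; exact: AC_loc_mulmx.
suff gv i (hi : (i < n)%N) t : g (Ordinal hi) *m v t = 0.
  by apply: constraint_derivative => t; case: k => i hi; exact: gv.
elim: i hi t => [|i IH] hi; apply: gv_ae.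
  by apply: ae_imp Ev => t <-; rewrite mulmxA g0// mul0mx.
pose hi' : (i < n)%N := ltnW hi.
apply: ae_imp2 Ev (constraint_derivative (IH hi')) => t <-.
have [gE gB] := gS (Ordinal hi') (Ordinal hi) erefl.
rewrite mulmxDr !mulmxA gB mul0mx addr0 => gA.
by rewrite -[LHS]addr0 -gA -mulmxDl gE mul0mx.
Qed.

End Trajectory.

Section Matrices.
Variables (N : 'M[R]_r) (L1 : 'M[R]_(r, \sum_(i < n) m)) (L2 : 'M[R]_(r, m)).
Variables (L3 L4 : 'M[R]_(r, p)).
Hypothesis L1F : L1 *m bidiagF E A B = 0.
Hypothesis KE : K = L1 *m calA A + L2 *m E + L3 *m C.
Hypothesis NKE : N *m K = L2 *m A + L4 *m C.

(* the index of the last block row of bidiagF *)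
Variable k : 'I_n.
Hypothesis kn : k.+1 = n.
Let Bu := submxrow L1 k *m B.

Definition observer_input_mx : 'M[R]_(r, l + p) :=
  row_mx (L2 *m B - N *m Bu) (N *m L3 - L4).
Definition observer_feedthrough_mx : 'M[R]_(r, l + p) := row_mx (- Bu) L3.

(** The solution is w = L2 v. On a trajectory the last block g of L1 satisfies
    g A x = - g B u, so L1 *m calA A *m x is the known quantity - g B u and
    K = L1 calA + L2 E + L3 C turns into z = w - g B u + L3 y. The derivative of w
    is L2 A x + L2 B u = N z - L4 y + L2 B u, in which z is replaced by w. *)
Lemma functional_is_observer_solution x u y z : behavior E A B C K (x, u, y, z) ->
  exists2 w, AC_loc w & \forall t \ae mu,
    is_derive (t : R) 1 w (N *m w t + observer_input_mx *m col_mx (u t) (y t)) /\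
    z t = w t + observer_feedthrough_mx *m col_mx (u t) (y t).
Proof.
move=> [_ [v [ACv Ev dyn]]].
have dv : \forall t \ae mu, is_derive (t : R) 1 v (A *m x t + B *m u t).
  by apply: ae_imp dyn => t [].
exists (fun t => L2 *m v t); first exact: AC_loc_mulmx.
have constr := hidden_constraints ACv Ev dv k L1F.
have {constr}Eg := ae_imp2 (fun t => @conj _ _) Ev constr.
apply: ae_imp2 dyn Eg => t [dvt yE zE] [Evt gt].
have zE' : z t = L2 *m v t + observer_feedthrough_mx *m col_mx (u t) (y t).
  rewrite zE KE mul_row_col !mulmxDl (mul_calA A L1 kn).
  rewrite -Evt yE -!mulmxA.
  move: gt; rewrite mulmxDr mulmxA -!mulmxA => /eqP; rewrite addr_eq0 => /eqP ->.
  by rewrite mulNmx !mulmxA addrA [X in X + _]addrC.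
split=> //.
have := is_derive_mulmx L2 dvt; congr (is_derive _ _ _ _).
have NzE : N *m z t = L2 *m A *m x t + L4 *m y t.
  by rewrite zE mulmxA NKE mulmxDl yE !mulmxA.
have -> : L2 *m (A *m x t + B *m u t) = N *m z t - L4 *m y t + L2 *m B *m u t.
  by rewrite NzE addrK mulmxDr !mulmxA.
rewrite zE' /observer_input_mx /observer_feedthrough_mx !mul_row_col.
rewrite !mulmxDr !mulmxBl !mulNmx !mulmxN !mulmxA.
move: (N *m L2 *m v t) (N *m Bu *m u t) (N *m L3 *m y t) (L4 *m y t)
  (L2 *m B *m u t) => a b c d e.
by apply/matrixP => i j; rewrite !mxE; ring.
Qed.

(** The error e = w - w0 of any solution w with respect to the solution w0 given
    by the trajectory itself satisfies e' = N e, and zhat - z = e. *)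
Lemma observer_of_matrices : hurwitz N ->
  functional_ODE_observer E A B C K N observer_input_mx 1%:M
    observer_feedthrough_mx.
Proof.
move=> Nstab x u y z beh.
have [w0 ACw0 w0E] := functional_is_observer_solution beh.
case: (beh) => -[_ _ _ Lz] _.
split.
  exists w0, z; split=> //.
  by apply: ae_imp w0E => t [dw zE]; rewrite mul1mx.
move=> w zh [ACw _ wE].
pose e t := w t - w0 t.
have ACe : AC_loc e by apply: AC_locD => //; exact: AC_locN.
have eE : \forall t \ae mu, is_derive (t : R) 1 e (N *m e t) /\ zh t - z t = e t.
  apply: ae_imp2 w0E wE => t [dw0 zE] [dw zhE]; split.
    have := is_deriveB dw dw0; congr (is_derive _ _ _ _).
    by rewrite /e mulmxBr opprD addrACA subrr addr0.
  by rewrite zhE zE mul1mx opprD addrACA subrr addr0.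
have de : \forall t \ae mu, is_derive (t : R) 1 e (N *m e t).
  by apply: ae_imp eE => t [].
have ze : \forall t \ae mu, zh t - z t = e t by apply: ae_imp eE => t [].
split.
  have [a [h [S [a0 Slyap]]]] := hurwitz_lyapunov Nstab.
  exact: ess_cvg0_of_cvg0 ze (lyapunov_decay ACe de a0 Slyap).
move=> [g [cg zg g0]].
have ge t : e t - g t = 0.
  apply: (@ae0_continuous_eq0 _ _ (fun t => e t - g t)) => [s|].
    by apply: cvgB; [exact: AC_loc_continuous|exact: cg].
  by apply: ae_imp2 ze zg => s -> ->; rewrite subrr.
have e0 : e 0 = 0 by rewrite -(ge 0) g0 subr0.
apply: ae_imp ze => t zt; apply/esym/eqP; rewrite -subr_eq0 zt.
by rewrite (linear_ode_unique ACe de e0).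
Qed.

End Matrices.
End Functional.
End Observer.

Theorem theorem1 (R : realType) (m n l p r : nat)
  (hm : (0 < m)%N) (hn : (0 < n)%N) (hl : (0 < l)%N) (hp : (0 < p)%N)
  (hr : (0 < r)%N)
  (E A : 'M[R]_(m, n)) (B : 'M[R]_(m, l))
  (C : 'M[R]_(p, n)) (K : 'M[R]_(r, n))
  (hB : behavior E A B C K !=set0)
  (hPsi : \rank (Psi E A B C K) = \rank (Gamma E A B C K))
  (hOmega : forall lambda : R[i], 0 <= complex.Re lambda ->
     \rank (Omega E A B C K lambda) = \rank (Gamma E A B C K)) :
  exists (q : nat) (N : 'M[R]_q) (H : 'M[R]_(q, l + p))
         (Rw : 'M[R]_(r, q)) (M : 'M[R]_(r, l + p)),
    (q <= r)%N /\ functional_ODE_observer E A B C K N H Rw M.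
Proof.
pose cx := fun a b (X : 'M[R]_(a, b)) => map_mx (real_complex R) X.
have Xsub := Kdot_sub hPsi.
have mapKd : cx _ _ (Kdot (l := l) K) = Kdot (cx _ _ K).
  by rewrite /cx /Kdot /row_mx3 !map_row_mx !map_mx0.
have mapKv : cx _ _ (Kval (l := l) K) = Kval (cx _ _ K).
  by rewrite /cx /Kval /row_mx3 !map_row_mx !map_mx0.
have mapQ := map_outputs_mx (real_complex R) E A B C.
have XsubC : (Kdot (cx _ _ K) <=
    outputs_mx (cx _ _ E) (cx _ _ A) (cx _ _ B) (cx _ _ C) + Kval (cx _ _ K))%MS.
  by rewrite -mapQ -mapKd -mapKv -map_addsmx map_submx.
have rankG : \rank (Gamma (cx _ _ E) (cx _ _ A) (cx _ _ B) (cx _ _ C) (cx _ _ K)) =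
    \rank (Gamma E A B C K).
  by rewrite !Gamma_rowspace -mapQ -mapKv -map_addsmx mxrank_map.
have Ysub (c : R[i]) : 0 <= complex.Re c ->
    (cx _ _ (Kval K) <= cx _ _ (outputs_mx E A B C) +
       (cx _ _ (Kdot K) + c *: cx _ _ (Kval K))%R)%MS.
  move=> /hOmega; rewrite -rankG mapKv mapKd => rankO.
  by rewrite [X in (_ <= X + _)%MS]mapQ; exact: Kval_sub.
have [N Nstab] := hurwitz_relation Xsub Ysub.
have -> : Kdot (l := l) K + N *m Kval K = row_mx3 0 K (N *m K).
  by rewrite /Kdot /Kval /row_mx3 !mul_mx_row !add_row_mx !mulmx0 !addr0 add0r.
move=> /outputs_subP[L1 [L2 [L3 [L4 [L1F KE NKE]]]]].
have kn : (n.-1 < n)%N by rewrite ltn_predL.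
exists r, N, (observer_input_mx B N L1 L2 L3 L4 (Ordinal kn)), 1%:M,
  (observer_feedthrough_mx B L1 L3 (Ordinal kn)).
by split=> //; apply: observer_of_matrices => //=; exact: prednK.
Qed.
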